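(* Let $H$ be a complex Hilbert space, let $\mathcal{C}$ be a nonempty convex subset of $\widetilde{\mathbb{R}}^H$ and let $\Phi:\mathcal{C}\rightarrow\widetilde{\mathbb{R}}^H$ be a pointwise convex map. Then for any $\lambda\in(0,1)$ and $f,g\in\mathcal{C}$, $$\Phi\Big((1-\lambda)f+\lambda g\Big)\leq\int_0^1\Phi\Big((1-t)f+tg\Big)\,d\nu_\lambda(t)\leq(1-\lambda)\Phi(f)+\lambda\Phi(g).$$ If $\Phi$ is pointwise concave, the inequalities are reversed.
   Context: $\widetilde{\mathbb{R}}:=\mathbb{R}\cup\{+\infty\}$, and $\widetilde{\mathbb{R}}^H$ is the set of all functionals from $H$ to $\widetilde{\mathbb{R}}$. Inequalities between functionals are pointwise: $f\le g$ iff $f(x)\le g(x)$ for all $x\in H$. Algebraic operations and integrals of functionals are also pointwise in $x\in H$. A map $\Phi:\mathcal{C}\to\widetilde{\mathbb{R}}^H$ is pointwise convex (resp. concave) if $\Phi((1-s)f+sg)\le(1-s)\Phi(f)+s\Phi(g)$ (resp. $\ge$) for all $f,g\in\mathcal{C}$ and $s\in[0,1]$; for $s=0$ and $s=1$ the combination $(1-s)f+sg$ is read as $f$ and $g$ respectively. For $\lambda\in(0,1)$, $\nu_\lambda$ is the probability measure on $[0,1]$ given by $$d\nu_\lambda(t)=\Big((1-\lambda)(1-t)^{\frac{1-2\lambda}{\lambda}}+\lambda t^{\frac{2\lambda-1}{1-\lambda}}\Big)dt.$$ *)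

(* Defs.v *)
From HB Require Import structures.
From mathcomp Require Import all_boot all_order all_algebra.
From mathcomp Require Import complex.
From mathcomp Require Import all_classical all_reals all_analysis.
From mathcomp Require Import measurable_realfun.

Set Implicit Arguments.
Unset Strict Implicit.
Unset Printing Implicit Defensive.

Import Order.TTheory GRing.Theory Num.Theory.
Import numFieldNormedType.Exports.

Local Open Scope classical_set_scope.
Local Open Scope ring_scope.

Section Functionals.
Context {R : realType} {H : Type}.
Implicit Types (f g : H -> \bar R) (C : set (H -> \bar R))
  (Phi : (H -> \bar R) -> H -> \bar R).

(* The functionals from H to R with +oo adjoined. *)
Definition functionals : set (H -> \bar R) := [set f | forall x, f x != -oo%E].

(* (1 - s) f + s g.  Since 0 * +oo = 0 in \bar R, this is f for s = 0 and g for
   s = 1 even at the points where the other functional is +oo. *)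
Definition fconv (s : R) f g : H -> \bar R :=
  fun x => ((1 - s)%:E * f x + s%:E * g x)%E.

Definition fconvex_set C := forall f g (s : R),
  C f -> C g -> 0 <= s <= 1 -> C (fconv s f g).

(* Phi stands for a map defined on C: its values outside C are irrelevant. *)
Definition pointwise_convex C Phi := forall f g (s : R),
  C f -> C g -> 0 <= s <= 1 ->
  forall x, (Phi (fconv s f g) x <= fconv s (Phi f) (Phi g) x)%E.

Definition pointwise_concave C Phi := forall f g (s : R),
  C f -> C g -> 0 <= s <= 1 ->
  forall x, (fconv s (Phi f) (Phi g) x <= Phi (fconv s f g) x)%E.

End Functionals.

Section Nu.
Context {R : realType} (lam : R).

(* powR sends 0 to a finite value also when the exponent is negative, which
   concerns the endpoints t = 0 and t = 1 only. *)
Definition nu_density (t : R) : R :=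
  (1 - lam) * (1 - t) `^ ((1 - 2 * lam) / lam)
  + lam * t `^ ((2 * lam - 1) / (1 - lam)).

(* The condition on lam, although not used by the formula, makes the density
   nonnegative; the measure instance below depends on it. *)
Definition nu (lam01 : 0 < lam < 1) : set (measurableTypeR R) -> \bar R :=
  fun A => (\int[lebesgue_measure]_(t in A `&` `[0%R, 1%R]) (nu_density t)%:E)%E.

Lemma measurable_nu_density : measurable_fun setT nu_density.
Proof.
apply: measurable_funD; apply: measurable_funM => //.
apply: (measurableT_comp (measurable_powR _)).
exact: measurable_funB.
Qed.

Hypothesis lam01 : 0 < lam < 1.

Lemma nu_density_ge0 t : 0 <= nu_density t.
Proof.
case/andP: lam01 => l0 l1.
by rewrite addr_ge0// mulr_ge0 ?powR_ge0// ?subr_ge0 ltW.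
Qed.

Let nu0 : nu lam01 set0 = 0%E.
Proof. by rewrite /nu set0I integral_set0. Qed.

Let nu_ge0 A : (0 <= nu lam01 A)%E.
Proof. by apply: integral_ge0 => t _; rewrite lee_fin nu_density_ge0. Qed.

Let nu_sigma_additive : semi_sigma_additive (nu lam01).
Proof.
move=> F mF tF mUF; rewrite /nu setI_bigcupl.
apply: (@semi_sigma_additive_nng_induced _ _ _ lebesgue_measure
  (fun t : measurableTypeR R => (nu_density t)%:E)
  _ _ (fun i => F i `&` `[0%R, 1%R])).
- by apply/measurable_EFinP; exact: measurable_nu_density.
- by move=> t; rewrite lee_fin nu_density_ge0.
- by move=> i; exact: measurableI.
- exact: trivIset_setIr.
- by rewrite -setI_bigcupl; exact: measurableI.
Qed.

HB.instance Definition _ := isMeasure.Build _ _ _ (nu lam01)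
  nu0 nu_ge0 nu_sigma_additive.

End Nu.

(* Main.v *)
Require Import Defs.
From HB Require Import structures.
From mathcomp Require Import all_boot all_order all_algebra.
From mathcomp Require Import complex.
From mathcomp Require Import all_classical all_reals all_analysis.
From mathcomp Require Import measurable_realfun.
From mathcomp Require Import ring lra.

(** Fix a point x.  Along the segment from f to g the map
    h t = Phi ((1 - t) f + t g) x is convex (resp. concave) on [0, 1] and never
    takes the value -oo, so everything reduces to functions of one real variable
    with values in the reals extended by +oo.

    The measure nu_lam is a probability measure on [0, 1] with barycentre lam.
    With p = (1 - lam) / lam and q = lam / (1 - lam), an antiderivative of its
    density is F t = (1 - lam) t^q - lam (1 - t)^p, which runs from - lam to
    1 - lam, and the mean follows by one integration by parts.  Hence an affine
    function has at lam the value of its integral ([integral_nu_affine]), and the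
    two inequalities are the two halves of the Hermite-Hadamard argument:
    - the right one integrates the chord from (0, h 0) to (1, h 1), which lies
      above a convex h;
    - the left one is Jensen's inequality: it integrates a supporting line of h
      at lam ([convex01_support]).

    The supporting line may fail to exist when h takes the value +oo: at lam
    itself, or on one whole side of lam, where the tangent can be vertical.  In
    these cases h is +oo on ]0, lam[ or on ]lam, 1[, intervals of positive mass,
    and h is bounded below ([convex01_lbound]), so that its integral is +oo
    ([integral_eqy]).  In the concave case a single value +oo forces h to be +oo
    on all of ]0, 1[ ([concave01_eqy]); otherwise h is finite and - h is convex.

    The integral is defined by suprema over simple functions and is therefore
    monotone on arbitrary functions, measurable or not ([le_integral_pw]); this is
    how h is compared with affine functions and constants. *)

Import Order.TTheory GRing.Theory Num.Theory.
Import numFieldNormedType.Exports.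

Local Open Scope classical_set_scope.
Local Open Scope ring_scope.

(** * Monotonicity of the integral and measures with a density *)

Section monotone_integral.
Context d (T : measurableType d) (R : realType).
Variable mu : {measure set T -> \bar R}.
Implicit Types (D A : set T) (f g : T -> \bar R).
Local Open Scope ereal_scope.
Import HBNNSimple.

(** Each simple function below f is below g, so the supremum defining the
    integral of f is taken over a smaller set. *)
Lemma ge0_le_integral_pw D f g :
    (forall t, D t -> 0 <= f t) -> (forall t, D t -> f t <= g t) ->
  \int[mu]_(t in D) f t <= \int[mu]_(t in D) g t.
Proof.
move=> f0 fg.
have g0 t : D t -> 0 <= g t by move=> Dt; exact: le_trans (f0 t Dt) (fg t Dt).
rewrite !ge0_integralE//; apply: ge_ereal_sup => _ [s /= sf <-].
apply: ereal_sup_ubound; exists s => //= t.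
apply: (le_trans (sf t)); rewrite !patchE.
by case: ifPn => // /set_mem; exact: fg.
Qed.

Lemma le_integral_pw D f g : (forall t, D t -> f t <= g t) ->
  \int[mu]_(t in D) f t <= \int[mu]_(t in D) g t.
Proof.
move=> fg; rewrite [leLHS]integralE [leRHS]integralE; apply: leeB.
- apply: ge0_le_integral_pw => [t _|t /mem_set]; first exact: funepos_ge0.
  by apply: funepos_le => {}t /set_mem; exact: fg.
- apply: ge0_le_integral_pw => [t _|t /mem_set]; first exact: funeneg_ge0.
  by apply: funeneg_le => {}t /set_mem; exact: fg.
Qed.

(** The lower bound M keeps the integral of the negative part finite, so the
    infinite positive part decides. *)
Lemma integral_eqy D A f (M : R) : measurable D -> measurable A ->
    A `<=` D -> mu D < +oo -> mu A != 0 ->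
    (forall t, D t -> M%:E <= f t) -> (forall t, A t -> f t = +oo) ->
  \int[mu]_(t in D) f t = +oo.
Proof.
move=> mD mA AD Doo A0 Mf fA; rewrite integralE.
have -> : \int[mu]_(t in D) f^\+ t = +oo.
  apply/eqP; rewrite -leye_eq; have muA : 0 < mu A by rewrite lt0e A0 measure_ge0.
  rewrite -{1}(gt0_mulye muA) -integral_cst// -{1}(setIidr AD) integral_mkcondr.
  apply: ge0_le_integral_pw => t Dt; rewrite patchE; case: ifPn => //= At.
    by rewrite funeposE fA ?le_max ?lexx//; exact: set_mem.
  exact: funepos_ge0.
rewrite addye// gt_eqF// lteNr/=.
apply: (@le_lt_trans _ _ (\int[mu]_(t in D) (cst `|M|%:E) t)).
  apply: ge0_le_integral_pw => // t Dt; rewrite funenegE ge_max.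
  apply/andP; split; last by rewrite lee_fin.
  rewrite leeNl; apply: le_trans (Mf t Dt).
  by rewrite -EFinN lee_fin lerNl ler_normr lexx orbT.
by rewrite integral_cst// lte_mul_pinfty// lee_fin.
Qed.

End monotone_integral.

Section density.
Context d (T : measurableType d) (R : realType).
Variables mu nu : {measure set T -> \bar R}.
Variables (D : set T) (g : T -> R).
Hypotheses (mD : measurable D) (mg : measurable_fun D g).
Hypothesis g0 : forall t, 0 <= g t.
Hypothesis nug : forall A, measurable A -> A `<=` D ->
  nu A = (\int[mu]_(t in A) (g t)%:E)%E.
Local Open Scope ereal_scope.
Import HBNNSimple.

Let density_nnsfun (h : {nnsfun T >-> R}) :
  \int[nu]_(t in D) (h t)%:E = \int[mu]_(t in D) ((h t)%:E * (g t)%:E).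
Proof.
have mE r : measurable_fun D (fun t => (r * \1_(h @^-1` [set r]) t)%:E).
  by apply/measurable_EFinP/measurable_funTS; exact: measurable_funM.
have mgE : measurable_fun D (EFin \o g) by exact/measurable_EFinP.
under eq_integral do rewrite fimfunE -fsumEFin//.
rewrite ge0_integral_fsum//; last by move=> r t _; exact: nnfun_muleindic_ge0.
under [RHS]eq_integral => t tD.
  rewrite fimfunE -fsumEFin// ge0_mule_fsuml; last first.
    by move=> r; exact: nnfun_muleindic_ge0.
  over.
rewrite ge0_integral_fsum//; last 2 first.
- by move=> r; exact: emeasurable_funM.
- move=> r t _; apply: mule_ge0; last by rewrite lee_fin.
  by rewrite EFinM; exact: nnfun_muleindic_ge0.
apply: eq_fsbigr => r rh.
rewrite integralZl_indic_nnsfun//.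
under [RHS]eq_integral do rewrite EFinM -muleA.
have r0 : (0 <= r)%R by move: rh; rewrite inE => -[t _ <-].
rewrite [RHS]ge0_integralZl//; last 2 first.
- apply: emeasurable_funM => //; apply/measurable_EFinP/measurable_funTS.
  exact: measurable_indic.
- by move=> t _; rewrite mule_ge0 ?lee_fin.
have mhr : measurable (h @^-1` [set r]) by [].
congr (_ * _); rewrite integral_indic// (nug _ (measurableI _ _ mhr mD))//.
rewrite setIC integral_mkcondr; apply: eq_integral => t _.
by rewrite epatch_indic muleC.
Qed.

(** The formula is the hypothesis on nu for indicator functions; it extends to
    simple functions by linearity and to f by monotone convergence. *)
Lemma ge0_integral_density (f : T -> \bar R) :
    measurable_fun D f -> (forall t, D t -> 0 <= f t) ->
  \int[nu]_(t in D) f t = \int[mu]_(t in D) (f t * (g t)%:E).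
Proof.
move=> mf f0; pose h := nnsfun_approx mD mf.
have mgE : measurable_fun D (EFin \o g) by exact/measurable_EFinP.
transitivity (limn (fun n => \int[nu]_(t in D) (h n t)%:E)).
  rewrite -monotone_convergence//=.
  - apply: eq_integral => t /[!inE] tD; apply/esym/cvg_lim => //=.
    exact: cvg_nnsfun_approx.
  - by move=> n; apply: measurableT_comp => //; exact: measurable_funTS.
  - by move=> n x _; rewrite lee_fin.
  - by move=> x _ a b ab; rewrite lee_fin//; exact/lefP/nd_nnsfun_approx.
under eq_fun do rewrite density_nnsfun.
rewrite -monotone_convergence//=.
- apply: eq_integral => t /[!inE] tD; apply/cvg_lim => //=.
  by apply: cvgeZr => //; exact: cvg_nnsfun_approx.
- move=> n; apply: emeasurable_funM => //.
  by apply: measurableT_comp => //; exact: measurable_funTS.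
- by move=> n x _; rewrite mule_ge0// lee_fin.
- move=> x _ a b ab; rewrite lee_wpmul2r// ?lee_fin//.
  exact/lefP/nd_nnsfun_approx.
Qed.

End density.

(** * The fundamental theorem of calculus on an open interval *)

Section improper_FTC.
Context {R : realType}.
Local Notation mu := (@lebesgue_measure R).

(** The integrand may be unbounded at the endpoints, as a power with a negative
    exponent is at 0.  The interval is exhausted by compact ones, on which the
    usual theorem applies, and monotone convergence passes to the limit. *)
Lemma ge0_integral_oo (f F : R -> R) (a b la lb : R) : a < b ->
    (forall t, a < t < b -> 0 <= f t) ->
    (forall t, a < t < b -> {for t, continuous f}) ->
    (forall t, a < t < b -> is_derive t (1 : R) F (f t)) ->
    F t @[t --> a^'+] --> la -> F t @[t --> b^'-] --> lb ->
  (\int[mu]_(t in `]a, b[) (f t)%:E = (lb - la)%:E)%E.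
Proof.
move=> ab f0 cf dF Fa Fb.
(* The factor 1/3 keeps a + e n < b - e n already for n = 0. *)
pose e (n : nat) : R := (b - a) / 3 * harmonic n.
have ba0 : 0 < (b - a) / 3 by rewrite divr_gt0// subr_gt0.
have e0 n : 0 < e n by rewrite mulr_gt0// harmonic_gt0.
have ab_e n : a + e n < b - e n.
  have : e n <= (b - a) / 3 by rewrite ger_pMr// invf_le1// ler1n.
  by lra.
have e_nincr m n : (m <= n)%N -> e n <= e m.
  by move=> mn; rewrite /e ler_pM2l// lef_pV2 ?posrE// ler_nat.
have e_cvg : e n @[n --> \oo] --> 0.
  by rewrite -(mulr0 ((b - a) / 3)); apply: cvgMr; exact: cvg_harmonic.
pose E n : set R := `[a + e n, b - e n]%classic.
have EU : \bigcup_n E n = `]a, b[%classic.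
  apply/seteqP; split => t /=.
    move=> [n _]; rewrite /E /= !in_itv/= => /andP[t1 t2].
    by have e0n := e0 n; apply/andP; split; lra.
  rewrite in_itv/= => /andP[t1 t2].
  have d0 : 0 < Num.min (t - a) (b - t) by rewrite lt_min !subr_gt0 t1 t2.
  have [n _ /(_ n (leqnn n)) /= nd] := cvgr_lt _ e_cvg _ d0.
  exists n => //; rewrite /E /= in_itv/=.
  by move: nd; rewrite lt_min => /andP[? ?]; apply/andP; split; lra.
have Ein n t : E n t -> a < t < b.
  by move=> Et; have : (\bigcup_n E n) t; [exists n|rewrite EU /= in_itv].
have cfE n : {within E n, continuous f}.
  by apply: continuous_in_subspaceT => t /set_mem /Ein; exact: cf.
have E_incr : nondecreasing_seq E.
  move=> m n mn; apply/subsetPset => t; rewrite /E /= !in_itv/= => /andP[? ?].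
  by have emn := e_nincr _ _ mn; apply/andP; split; lra.
have dFE n t : t \in `]a + e n, b - e n[ -> is_derive t (1 : R) F (f t).
  rewrite in_itv/= => /andP[t1 t2]; apply: dF; apply: (Ein n).
  by rewrite /E /= in_itv/= !ltW.
have Fcvg t : a < t < b -> {for t, continuous F}.
  move=> /dF dFt; apply: differentiable_continuous; apply/derivable1_diffP.
  exact: ex_derive.
have intE n : (\int[mu]_(t in E n) (f t)%:E = (F (b - e n) - F (a + e n))%:E)%E.
  rewrite EFinB; apply: continuous_FTC2 => //.
  - exact: cfE.
  - split.
    + by move=> t /dFE tE; exact: ex_derive.
    + apply: cvg_at_right_filter; apply: Fcvg; apply: (Ein n).
      by rewrite /E /= in_itv/= lexx ltW.
    + apply: cvg_at_left_filter; apply: Fcvg; apply: (Ein n).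
      by rewrite /E /= in_itv/= lexx ltW.
  - by move=> t /dFE tE; rewrite derive1E; exact: derive_val.
have intE_cvg : (\int[mu]_(t in E n) (f t)%:E)%E @[n --> \oo] -->
    (\int[mu]_(t in \bigcup_n E n) (f t)%:E)%E.
  apply: ge0_nondecreasing_set_cvg_integral => //.
  - by move=> n; exact: measurable_itv.
  - move=> n; apply/measurable_EFinP.
    by apply: subspace_continuous_measurable_fun; [exact: measurable_itv|exact: cfE].
  - by move=> n t /Ein; rewrite lee_fin; exact: f0.
rewrite -EU -(cvg_lim _ intE_cvg)//; apply/cvg_lim => //.
under eq_fun do rewrite intE.
apply: cvg_EFin; first exact: nearW.
apply: cvgB.
- move/cvg_at_leftP : Fb; apply; split=> [n|]; first by rewrite gtrBl.
  by rewrite -[X in _ --> X]subr0; apply: cvgB => //; exact: cvg_cst.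
- move/cvg_at_rightP : Fa; apply; split=> [n|]; first by rewrite ltrDl.
  by rewrite -[X in _ --> X]addr0; apply: cvgD => //; exact: cvg_cst.
Qed.

End improper_FTC.

(** * Total mass and barycentre of nu *)

Section power_functions.
Context {R : realType}.
Implicit Types r t : R.

Lemma is_derive_powR_onem r t : t < 1 ->
  is_derive t (1 : R) (fun x => (1 - x) `^ r) (- (r * (1 - t) `^ (r - 1))).
Proof.
move=> t1; have t0 : 0 < 1 - t by rewrite subr_gt0.
have dB : is_derive t (1 : R) (fun x : R => 1 - x) (-1).
  by apply: is_derive_eq; rewrite add0r mul1r.
have dr := @is_derive1_powR _ r _ t0.
have := @is_derive1_comp _ (fun x : R => x `^ r) (fun x : R => 1 - x) t _ _ dr dB.
by rewrite mulrN1.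
Qed.

Lemma powR_cvg_gt0 r t : 0 < t -> x `^ r @[x --> t] --> t `^ r.
Proof.
move=> t0; have [dr _] := @is_derive1_powR _ r _ t0.
by move/derivable1_diffP/differentiable_continuous : dr.
Qed.

Lemma powR_onem_cvg_lt1 r t : t < 1 -> (1 - x) `^ r @[x --> t] --> (1 - t) `^ r.
Proof.
move=> t1; have [dr _] := is_derive_powR_onem r t t1.
by move/derivable1_diffP/differentiable_continuous : dr.
Qed.

Lemma powR_cvg_1l r : x `^ r @[x --> (1 : R)^'-] --> (1 : R).
Proof.
apply: cvg_at_left_filter.
by have := powR_cvg_gt0 r 1 ltr01; rewrite powR1.
Qed.

Lemma powR_onem_cvg_0r r : (1 - x) `^ r @[x --> (0 : R)^'+] --> (1 : R).
Proof.
apply: cvg_at_right_filter.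
by have := powR_onem_cvg_lt1 r 0 ltr01; rewrite subr0 powR1.
Qed.

Lemma powR_onem_cvg_1l r : 0 < r -> (1 - x) `^ r @[x --> (1 : R)^'-] --> (0 : R).
Proof.
move=> r0; apply/cvg_at_leftP => u [u1 cu].
have /cvg_at_rightP := powR_cvg0 r0.
apply; split=> [n|]; first by rewrite subr_gt0.
by rewrite -(subrr (1 : R)); apply: cvgB => //; exact: cvg_cst.
Qed.

End power_functions.

Section nu_moments.
Context {R : realType} (lam : R) (lam01 : 0 < lam < 1).
Local Notation mu := (@lebesgue_measure R).

Let p : R := (1 - lam) / lam.
Let q : R := lam / (1 - lam).
Let lam0 : 0 < lam. Proof. by case/andP: lam01. Qed.
Let lam1 : 0 < 1 - lam. Proof. by rewrite subr_gt0; case/andP: lam01. Qed.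
Let p0 : 0 < p. Proof. exact: divr_gt0. Qed.
Let q0 : 0 < q. Proof. exact: divr_gt0. Qed.

Let densityE t :
  nu_density lam t = (1 - lam) * (1 - t) `^ (p - 1) + lam * t `^ (q - 1).
Proof.
rewrite /nu_density /p /q; congr (_ * _ `^ _ + _ * _ `^ _); field;
  by rewrite gt_eqF.
Qed.

Lemma nu_density_gt0 (t : R) : 0 < t < 1 -> 0 < nu_density lam t.
Proof.
move=> /andP[t0 t1]; rewrite /nu_density addr_gt0// mulr_gt0//.
- by rewrite powR_gt0// subr_gt0.
- by rewrite powR_gt0.
Qed.

Let density_continuous (t : R) : 0 < t < 1 -> {for t, continuous (nu_density lam)}.
Proof.
move=> /andP[t0 t1]; rewrite /prop_for /continuous_at /nu_density; apply: cvgD.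
- by apply: cvgMr; exact: powR_onem_cvg_lt1.
- by apply: cvgMr; exact: powR_cvg_gt0.
Qed.

(** An antiderivative of the density. *)
Let F t : R := (1 - lam) * t `^ q - lam * (1 - t) `^ p.

Let F_derive (t : R) : 0 < t < 1 -> is_derive t (1 : R) F (nu_density lam t).
Proof.
move=> /andP[t0 t1]; rewrite /F densityE.
have d1 := @is_derive1_powR _ q _ t0.
have d2 := is_derive_powR_onem p t t1.
apply: is_derive_eq.
rewrite /GRing.scale/= /p /q.
by field; rewrite !gt_eqF.
Qed.

Let F_cvg0 : F t @[t --> (0 : R)^'+] --> - lam.
Proof.
have -> : - lam = (1 - lam) * 0 - lam * 1 by ring.
by apply: cvgB; apply: cvgMr; [exact: powR_cvg0|exact: powR_onem_cvg_0r].
Qed.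

Let F_cvg1 : F t @[t --> (1 : R)^'-] --> 1 - lam.
Proof.
have -> : 1 - lam = (1 - lam) * 1 - lam * 0 by ring.
by apply: cvgB; apply: cvgMr; [exact: powR_cvg_1l|exact: powR_onem_cvg_1l].
Qed.

(** An antiderivative of F. *)
Let Psi t : R := lam ^+ 2 * (1 - t) `^ (p + 1) + (1 - lam) ^+ 2 * t `^ (q + 1).

(** Integration by parts: an antiderivative of t times the density. *)
Let G t : R := t * F t - Psi t.

Let Psi_derive (t : R) : 0 < t < 1 -> is_derive t (1 : R) Psi (F t).
Proof.
move=> /andP[t0 t1]; rewrite /F /Psi.
have d1 := @is_derive1_powR _ (q + 1) _ t0.
have d2 := is_derive_powR_onem (p + 1) t t1.
apply: is_derive_eq.
rewrite /GRing.scale/= !addrK /p /q.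
by field; rewrite !gt_eqF.
Qed.

Let G_derive (t : R) : 0 < t < 1 -> is_derive t (1 : R) G (t * nu_density lam t).
Proof.
move=> t01; rewrite /G.
have d1 := F_derive t t01.
have d2 := Psi_derive t t01.
apply: is_derive_eq.
by rewrite /GRing.scale/= mulr1 addrK.
Qed.

Let p10 : 0 < p + 1. Proof. exact: addr_gt0. Qed.
Let q10 : 0 < q + 1. Proof. exact: addr_gt0. Qed.

Let G_cvg0 : G t @[t --> (0 : R)^'+] --> - lam ^+ 2.
Proof.
have -> : - lam ^+ 2 = 0 * - lam - (lam ^+ 2 * 1 + (1 - lam) ^+ 2 * 0) by ring.
apply: cvgB; first by apply: cvgM => //; exact: cvg_at_right_filter.
by apply: cvgD; apply: cvgMr; [exact: powR_onem_cvg_0r|exact: powR_cvg0].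
Qed.

Let G_cvg1 : G t @[t --> (1 : R)^'-] --> lam * (1 - lam).
Proof.
have -> : lam * (1 - lam) =
  1 * (1 - lam) - (lam ^+ 2 * 0 + (1 - lam) ^+ 2 * 1) by ring.
apply: cvgB; first by apply: cvgM => //; exact: cvg_at_left_filter.
by apply: cvgD; apply: cvgMr; [exact: powR_onem_cvg_1l|exact: powR_cvg_1l].
Qed.

Local Open Scope ereal_scope.

Let m_density : measurable_fun setT (EFin \o nu_density lam).
Proof. apply/measurable_EFinP. exact: (measurable_nu_density lam). Qed.

(** With the measure structure made explicit, facts about nu can be rewritten in
    results on general measures. *)
Local Notation nu_measure :=
  (nu lam01 : {measure set (measurableTypeR R) -> \bar R}).

Lemma nu_itv01 : nu_measure `[0%R, 1%R]%classic = 1.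
Proof.
change (nu lam01 `[0%R, 1%R]%classic = 1).
rewrite /nu setIid integral_itv_bndoo; last exact: measurable_funTS.
transitivity ((1 - lam) - (- lam))%:E; last by rewrite opprK subrK.
apply: (@ge0_integral_oo _ (nu_density lam) F 0 1 _ _ ltr01) => // t _.
exact: nu_density_ge0.
Qed.

Lemma integral_nu_id : \int[nu lam01]_(t in `[0%R, 1%R]) t%:E = lam%:E.
Proof.
rewrite (@ge0_integral_density _ _ _ (@lebesgue_measure R) (nu lam01)
  `[0%R, 1%R]%classic (nu_density lam))//.
- under eq_integral do rewrite -EFinM.
  rewrite integral_itv_bndoo; last first.
    apply/measurable_EFinP/measurable_funM; first exact: measurable_id.
    exact: measurable_funTS (measurable_nu_density lam).
  transitivity (lam * (1 - lam) - (- lam ^+ 2))%:E; last by congr EFin; ring.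
  apply: (@ge0_integral_oo _ (fun t => t * nu_density lam t)%R G 0 1 _ _ ltr01)
    => //.
  + by move=> t /andP[t0 t1]; rewrite mulr_ge0 ?nu_density_ge0// ltW.
  + by move=> t t01; apply: cvgM; [exact: cvg_id|exact: density_continuous].
- exact: measurable_funTS (measurable_nu_density lam).
- by move=> t; exact: nu_density_ge0.
- move=> A mA AD; change (nu lam01 A = \int[mu]_(t in A) (nu_density lam t)%:E).
  by rewrite /nu (setIidl AD).
- by move=> t /=; rewrite in_itv/= lee_fin => /andP[].
Qed.

(** Total mass 1 and barycentre lam in one formula, the only information on nu
    used to integrate chords and supporting lines. *)
Lemma integral_nu_affine (a b : R) :
  \int[nu lam01]_(t in `[0%R, 1%R]) (a + b * t)%:E = (a + b * lam)%:E.
Proof.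
have ia : (nu lam01).-integrable `[0%R, 1%R] (cst a%:E).
  apply/integrableP; split => //.
  by rewrite integral_cst// nu_itv01 mule1 ltry.
have it : (nu lam01).-integrable `[0%R, 1%R] EFin.
  apply/integrableP; split; first by apply/measurable_EFinP; exact: measurable_id.
  rewrite [ltLHS](_ : _ = \int[nu lam01]_(t in `[0%R, 1%R]) t%:E).
    by rewrite integral_nu_id ltry.
  apply: eq_integral => t /[!inE]/=.
  by rewrite in_itv/= => /andP[t0 _]; rewrite ger0_norm.
under eq_integral do rewrite EFinD EFinM.
rewrite integralD//=; last exact: integrableZl.
by rewrite integralZl// integral_nu_id integral_cst// nu_itv01 mule1.
Qed.

(** If the integral of the density over the interval vanished, the density would
    vanish almost everywhere there, but it is positive inside ]0, 1[. *)
Lemma nu_itv_neq0 (a b : R) : (0 <= a < b)%R -> (b <= 1)%R ->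
  nu_measure `]a, b[%classic != 0.
Proof.
move=> /andP[a0 ab] b1; apply/eqP; change (nu lam01 `]a, b[%classic <> 0).
rewrite /nu (setIidl _); last first.
  move=> t /=; rewrite !in_itv/= => /andP[t1 t2].
  by rewrite (le_trans a0 (ltW t1)) (le_trans (ltW t2) b1).
rewrite [X in X <> _](_ : _ =
    \int[@lebesgue_measure R]_(t in `]a, b[) `|(nu_density lam t)%:E|); last first.
  by apply: eq_integral => t _; rewrite gee0_abs// lee_fin nu_density_ge0.
move/ae_eq_integral_abs => /(_ _ _)[]//; first exact: measurable_funTS.
move=> N [mN N0 abN].
have : (@lebesgue_measure R) `]a, b[%classic <= (@lebesgue_measure R) N.
  apply: le_measure; rewrite ?inE//.
  move=> t tab; apply: abN => /= /(_ tab)/eqP.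
  rewrite eqe gt_eqF// nu_density_gt0//.
  move: tab; rewrite /= in_itv/= => /andP[t1 t2].
  by rewrite (le_lt_trans a0 t1) (lt_le_trans t2 b1).
rewrite N0 lebesgue_measure_itv/= lte_fin ab lee_fin subr_le0.
by rewrite leNgt ab.
Qed.

End nu_moments.

(** * Extended-real-valued convex functions on [0, 1] *)

Section convex_on_01.
Context {R : realType}.
Implicit Types (h : R -> \bar R) (s t a b c : R).

Definition convex01 h := forall a b s,
  0 <= a <= 1 -> 0 <= b <= 1 -> 0 <= s <= 1 ->
  (h ((1 - s) * a + s * b)%R <= (1 - s)%:E * h a + s%:E * h b)%E.

Definition neqNy01 h := forall t, 0 <= t <= 1 -> h t != -oo%E.

(** The three-point inequality, cleared of denominators; finiteness at a and b
    propagates to c. *)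
Lemma convex01_chord h a c b (y z : R) : convex01 h -> neqNy01 h ->
    0 <= a -> a < c -> c < b -> b <= 1 -> h a = y%:E -> h b = z%:E ->
  exists2 v : R, h c = v%:E & v * (b - a) <= (b - c) * y + (c - a) * z.
Proof.
move=> hcvx hp a0 ac cb b1 hay hbz.
have ba : 0 < b - a by lra.
pose s := (c - a) / (b - a).
have cE : (1 - s) * a + s * b = c by rewrite /s; field; rewrite gt_eqF.
have s01 : 0 <= s <= 1.
  rewrite /s; apply/andP; split; first by apply: divr_ge0; lra.
  by rewrite ler_pdivrMr// mul1r lerB// ltW.
have a01 : 0 <= a <= 1 by apply/andP; split; lra.
have b01 : 0 <= b <= 1 by apply/andP; split; lra.
have c01 : 0 <= c <= 1 by apply/andP; split; lra.
have := hcvx a b s a01 b01 s01.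
rewrite cE hay hbz -!EFinM -EFinD.
have := hp c c01; case: (h c) => [v| |]//= _.
rewrite lee_fin => vle; exists v => //.
rewrite -ler_pdivlMr//; apply: le_trans vle _.
by rewrite le_eqVlt; apply/orP; left; apply/eqP; rewrite /s; field; rewrite gt_eqF.
Qed.

(** Existence of a supporting line at c.  Its slope is the supremum of the slopes
    of the chords arriving at c from the left; finiteness of h on the left of c
    makes this set nonempty, finiteness on the right bounds it above by a slope
    of a chord leaving c. *)
Lemma convex01_support h a c b : convex01 h -> neqNy01 h ->
    0 <= a -> a < c -> c < b -> b <= 1 -> (h a < +oo)%E -> (h b < +oo)%E ->
  exists v k : R, h c = v%:E /\
    forall t, 0 <= t <= 1 -> ((v + k * (t - c))%:E <= h t)%E.
Proof.
move=> hcvx hp a0 ac cb b1 hay hby.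
have a01 : 0 <= a <= 1 by apply/andP; split; lra.
have b01 : 0 <= b <= 1 by apply/andP; split; lra.
have [y hyE] : exists y, h a = y%:E.
  by move: hay (hp a a01); case: (h a) => [r| |]//; exists r.
have [z hzE] : exists z, h b = z%:E.
  by move: hby (hp b b01); case: (h b) => [r| |]//; exists r.
have [v hcv _] := convex01_chord h a c b y z hcvx hp a0 ac cb b1 hyE hzE.
pose S := [set (v - (fine (h t))) / (c - t) | t in
  [set t | 0 <= t < c /\ (h t < +oo)%E]].
have slope t r w q : 0 <= t < c -> h t = r%:E -> c < w <= 1 -> h w = q%:E ->
    (v - r) / (c - t) <= (q - v) / (w - c).
  move=> /andP[t0 tc] htr /andP[cw w1] hwq.
  have [v' + ineq] := convex01_chord h t c w r q hcvx hp t0 tc cw w1 htr hwq.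
  rewrite hcv => -[vv']; rewrite -{v'}vv' in ineq.
  rewrite ler_pdivrMr ?subr_gt0// mulrAC ler_pdivlMr ?subr_gt0//.
  by nra.
have Sub w q : c < w <= 1 -> h w = q%:E -> ubound S ((q - v) / (w - c)).
  move=> cw1 hwq _ [t [t0c hty] <-].
  have t01 : 0 <= t <= 1 by move: t0c; lra.
  apply: slope hwq => //.
  by move: hty (hp t t01); case: (h t).
have S0 : S !=set0.
  by exists ((v - fine (h a)) / (c - a)), a => //=; rewrite a0 ac.
exists v, (sup S); split => // t /andP[t0 t1].
have t01 : 0 <= t <= 1 by rewrite t0.
move: (hp t t01); case htE : (h t) => [r| |]//= _; last by rewrite leey.
rewrite lee_fin.
have [tc|ct|tc] := ltgtP t c.
- have : (v - r) / (c - t) <= sup S.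
    apply: ub_le_sup; first by exists ((z - v) / (b - c)); apply: Sub => //; rewrite cb.
    by exists t => /=; rewrite htE // t0 tc ltry.
  by rewrite ler_pdivrMr ?subr_gt0//; lra.
- have : sup S <= (r - v) / (t - c).
    by apply: ge_sup => //; apply: Sub => //; rewrite ct.
  by rewrite ler_pdivlMr ?subr_gt0//; lra.
- by move: htE; rewrite tc hcv => -[->]; rewrite subrr mulr0 addr0.
Qed.

(** If h is finite at two points, it is finite between them and a supporting line
    at the midpoint is bounded below on [0, 1].  Otherwise h takes at most one
    finite value. *)
Lemma convex01_lbound h : convex01 h -> neqNy01 h ->
  exists M : R, forall t, 0 <= t <= 1 -> (M%:E <= h t)%E.
Proof.
move=> hcvx hp.
have [[a [b [a0 ab b1 ha hb]]]|none2] := pselect (exists a b,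
    [/\ 0 <= a, a < b, b <= 1, (h a < +oo)%E & (h b < +oo)%E]).
  have [||v [k [_ sup]]] := convex01_support h a ((a + b) / 2) b hcvx hp a0 _ _ b1 ha hb.
  - by lra.
  - by lra.
  (* |k (t - c)| <= |k| because t and c both lie in [0, 1]. *)
  exists (v - `|k|) => t t01; apply: le_trans (sup t t01); rewrite lee_fin.
  rewrite lerD2l -lerN2 opprK (le_trans (ler_norm _))// normrN normrM.
  by rewrite ler_piMr// ler_norml; apply/andP; split; lra.
have [[a [a01 ha]]|none1] := pselect (exists a, 0 <= a <= 1 /\ (h a < +oo)%E).
  exists (fine (h a)) => t t01; have [hty|] := ltP (h t) +oo%E; last first.
    by rewrite leye_eq => /eqP ->; rewrite leey.
  have [ta|at_|->] := ltgtP t a.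
  - by exfalso; apply: none2; exists t, a; split => //; lra.
  - by exfalso; apply: none2; exists a, t; split => //; lra.
  - by move: ha (hp a a01); case: (h a).
exists 0 => t t01; have [hty|] := ltP (h t) +oo%E; last first.
  by rewrite leye_eq => /eqP ->; rewrite leey.
by exfalso; apply: none1; exists t.
Qed.

End convex_on_01.

(** * Hermite-Hadamard inequalities for nu *)

Lemma mule_neqNy {R : realType} (r : R) (u : \bar R) :
  0 <= r -> u != -oo%E -> (r%:E * u != -oo)%E.
Proof.
move=> r0; case: u => [u| |]// _; move: r0.
rewrite le_eqVlt => /predU1P[<-|r0]; first by rewrite mul0e.
by rewrite gt0_muley// lte_fin.
Qed.

Section jensen.
Context {R : realType} (lam : R) (lam01 : 0 < lam < 1).
Implicit Types h : R -> \bar R.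
Local Open Scope ereal_scope.

Lemma integral_nu_eqy h (a b M : R) : (0 <= a < b)%R -> (b <= 1)%R ->
    (forall t, (0 <= t <= 1)%R -> M%:E <= h t) ->
    (forall t, (a < t < b)%R -> h t = +oo) ->
  \int[nu lam01]_(t in `[0%R, 1%R]) h t = +oo.
Proof.
move=> a0b b1 Mh hy.
apply: (@integral_eqy _ _ _ (nu lam01) _ `]a, b[%classic _ M).
- exact: measurable_itv.
- exact: measurable_itv.
- move=> t /=; rewrite !in_itv/= => /andP[t1 t2].
  by move: a0b b1; lra.
- by rewrite nu_itv01 ltry.
- exact: nu_itv_neq0.
- by move=> t /=; rewrite in_itv/=; exact: Mh.
- by move=> t /=; rewrite in_itv/=; exact: hy.
Qed.

(** Jensen's inequality.  When h is finite somewhere on each side of lam, a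
    supporting line at lam is integrated; when it is +oo on a whole side, the
    integral is +oo. *)
Lemma convex01_le_integral_nu h : convex01 h -> neqNy01 h ->
  h lam <= \int[nu lam01]_(t in `[0%R, 1%R]) h t.
Proof.
move=> hcvx hp; case/andP: (lam01) => lam0 lam1.
have [[a [a0 al ha]]|nol] :=
    pselect (exists a, [/\ (0 <= a)%R, (a < lam)%R & h a < +oo]); last first.
  have [M Mh] := convex01_lbound h hcvx hp.
  rewrite (integral_nu_eqy h 0 lam M) ?leey ?lexx ?ltW// => t /andP[t0 tl].
  apply/eqP; rewrite -leye_eq leNgt; apply/negP => hty.
  by apply: nol; exists t; split => //; exact: ltW.
have [[b [lb b1 hb]]|nor] :=
    pselect (exists b, [/\ (lam < b)%R, (b <= 1)%R & h b < +oo]); last first.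
  have [M Mh] := convex01_lbound h hcvx hp.
  rewrite (integral_nu_eqy h lam 1 M) ?leey ?lexx ?(ltW lam0)// => t /andP[tl t1].
  apply/eqP; rewrite -leye_eq leNgt; apply/negP => hty.
  by apply: nor; exists t; split => //; exact: ltW.
have [v [k [hv sup]]] := convex01_support h a lam b hcvx hp a0 al lb b1 ha hb.
rewrite hv; have -> : v = ((v - k * lam) + k * lam)%R by rewrite subrK.
rewrite -(integral_nu_affine lam lam01); apply: le_integral_pw => t /=.
rewrite in_itv/= => /sup; apply: le_trans.
by rewrite lee_fin mulrBr addrCA addrC addrAC.
Qed.

(** The chord over [0, 1] dominates h. *)
Lemma convex01_integral_nu_le h : convex01 h -> neqNy01 h ->
  \int[nu lam01]_(t in `[0%R, 1%R]) h t <= (1 - lam)%:E * h 0%R + lam%:E * h 1%R.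
Proof.
move=> hcvx hp; case/andP: (lam01) => lam0 lam1.
have i00 : (0 <= (0 : R) <= 1)%R by rewrite lexx ler01.
have i11 : (0 <= (1 : R) <= 1)%R by rewrite lexx ler01.
have hle t : (0 <= t <= 1)%R -> h t <= (1 - t)%:E * h 0%R + t%:E * h 1%R.
  by move=> t01; have := hcvx 0%R 1%R t i00 i11 t01; rewrite mulr0 mulr1 add0r.
have l10 : (0 < 1 - lam)%R by rewrite subr_gt0.
move: (hp 0%R i00) (hp 1%R i11) hle.
case: (h 0%R) => [y| |]// _; last first.
  case: (h 1%R) => [z| |]// _ _.
  - by rewrite gt0_muley ?lte_fin// leey.
  - by rewrite !gt0_muley ?lte_fin// leey.
case: (h 1%R) => [z| |]// _ hle; last by rewrite gt0_muley ?lte_fin// leey.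
rewrite -!EFinM -EFinD.
have -> : ((1 - lam) * y + lam * z = y + (z - y) * lam)%R by ring.
rewrite -(integral_nu_affine lam lam01); apply: le_integral_pw => t /=.
rewrite in_itv/= => /hle; move=> /le_trans; apply.
by rewrite -!EFinM -EFinD lee_fin le_eqVlt; apply/orP; left; apply/eqP; ring.
Qed.

Definition concave01 h := forall a b s : R,
  (0 <= a <= 1)%R -> (0 <= b <= 1)%R -> (0 <= s <= 1)%R ->
  (1 - s)%:E * h a + s%:E * h b <= h ((1 - s) * a + s * b)%R.

(** Every interior point is a convex combination of t0 and of an endpoint
    of [0, 1], with a positive weight on t0. *)
Lemma concave01_eqy h t0 t : concave01 h -> neqNy01 h ->
  (0 <= t0 <= 1)%R -> h t0 = +oo -> (0 < t < 1)%R -> h t = +oo.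
Proof.
move=> hccv hp t001 ht0 /andP[t_gt0 t_lt1].
have i00 : (0 <= (0 : R) <= 1)%R by rewrite lexx ler01.
have i11 : (0 <= (1 : R) <= 1)%R by rewrite lexx ler01.
have key b s : (0 <= b <= 1)%R -> (0 <= s < 1)%R ->
    h ((1 - s) * t0 + s * b)%R = +oo.
  move=> b01 /andP[s0 s1]; apply/eqP; rewrite -leye_eq.
  have s01 : (0 <= s <= 1)%R by rewrite s0 ltW.
  apply: le_trans (hccv _ _ _ t001 b01 s01).
  by rewrite ht0 gt0_muley ?lte_fin ?subr_gt0// addye// mule_neqNy ?hp.
case/andP: (t001) => t00 t0l.
have [tt|tt|->//] := ltgtP t t0.
- have t0p : (0 < t0)%R by exact: lt_trans tt.
  rewrite -(key 0%R (1 - t / t0)%R)//.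
    by congr h; field; rewrite gt_eqF.
  rewrite subr_ge0 ler_pdivrMr// mul1r ltW//= ltrBlDr ltrDl.
  exact: divr_gt0.
- have t0p : (0 < 1 - t0)%R by lra.
  rewrite -(key 1%R ((t - t0) / (1 - t0))%R)//.
    by congr h; field; rewrite gt_eqF.
  apply/andP; split; first by apply: divr_ge0; lra.
  by rewrite ltr_pdivrMr//; lra.
Qed.

Lemma concave01_integral_nu h : concave01 h -> neqNy01 h ->
  \int[nu lam01]_(t in `[0%R, 1%R]) h t <= h lam /\
  (1 - lam)%:E * h 0%R + lam%:E * h 1%R <= \int[nu lam01]_(t in `[0%R, 1%R]) h t.
Proof.
move=> hccv hp; case/andP: (lam01) => lam0 lam1.
have i00 : (0 <= (0 : R) <= 1)%R by rewrite lexx ler01.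
have i11 : (0 <= (1 : R) <= 1)%R by rewrite lexx ler01.
have hge t : (0 <= t <= 1)%R -> (1 - t)%:E * h 0%R + t%:E * h 1%R <= h t.
  by move=> t01; have := hccv 0%R 1%R t i00 i11 t01; rewrite mulr0 mulr1 add0r.
have [[t0 [t001 ht0]]|fin] := pselect (exists t, (0 <= t <= 1)%R /\ h t = +oo).
  have hy t := concave01_eqy h t0 t hccv hp t001 ht0.
  (* Interior values are +oo, so only the endpoints constrain the bound. *)
  rewrite (integral_nu_eqy h 0 1 (Num.min (fine (h 0%R)) (fine (h 1%R)))) ?lexx ?ltr01//.
    by rewrite hy ?leey.
  move=> t /andP[]; rewrite le_eqVlt => /predU1P[<- _|t_gt0].
    have := hp 0%R i00; case: (h 0%R) => [r| |]// _; last by rewrite leey.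
    by rewrite lee_fin ge_min lexx.
  rewrite le_eqVlt => /predU1P[->|t_lt1]; last by rewrite (hy t) ?leey ?t_gt0 ?t_lt1.
  have := hp 1%R i11; case: (h 1%R) => [r| |]// _; last by rewrite leey.
  by rewrite lee_fin ge_min lexx orbT.
have hfin t : (0 <= t <= 1)%R -> h t = (fine (h t))%:E.
  move=> t01; have := hp t t01; have : h t <> +oo by move=> ?; apply: fin; exists t.
  by case: (h t).
split.
  have Nhcvx : convex01 (\- h).
    move=> a b s a01 b01 s01 /=.
    have := hccv a b s a01 b01 s01.
    have c01 : (0 <= (1 - s) * a + s * b <= 1)%R.
      by apply/andP; split; nra.
    rewrite (hfin a a01) (hfin b b01) (hfin _ c01).
    by rewrite -!EFinN -!EFinM -!EFinD !lee_fin; lra.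
  have Nhp : neqNy01 (\- h) by move=> t t01 /=; rewrite hfin.
  have [||v [k [hv sup]]] := convex01_support (\- h) 0 lam 1 Nhcvx Nhp
    (lexx 0%R) lam0 lam1 (lexx 1%R).
  - by rewrite /= hfin// ltry.
  - by rewrite /= hfin// ltry.
  have -> : h lam = (- v)%:E by rewrite EFinN -hv oppeK.
  have -> : (- v = (- v + k * lam) + (- k) * lam)%R by ring.
  rewrite -(integral_nu_affine lam lam01); apply: le_integral_pw => t /=.
  rewrite in_itv/= => t01; have := sup t t01; rewrite /= hfin// -EFinN !lee_fin; lra.
rewrite (hfin 0%R)// (hfin 1%R)// -!EFinM -EFinD.
set y := fine (h 0%R); set z := fine (h 1%R).
have -> : ((1 - lam) * y + lam * z = y + (z - y) * lam)%R by ring.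
rewrite -(integral_nu_affine lam lam01); apply: le_integral_pw => t /=.
rewrite in_itv/= => /hge; apply: le_trans.
rewrite (hfin 0%R)// (hfin 1%R)// -!EFinM -EFinD lee_fin.
by rewrite le_eqVlt; apply/orP; left; apply/eqP; rewrite /y /z; ring.
Qed.

End jensen.

(** * Restriction to segments *)

Section segments.
Context {R : realType} {H : Type}.
Implicit Types (f g : H -> \bar R) (s a b : R).

Lemma fconv0 f g : fconv 0 f g = f.
Proof. by apply/funext => x; rewrite /fconv subr0 mul1e mul0e adde0. Qed.

Lemma fconv1 f g : fconv 1 f g = g.
Proof. by apply/funext => x; rewrite /fconv subrr mul1e mul0e add0e. Qed.

(** The parametrisation of the segment from f to g is affine, so convexity of
    Phi passes to h.  Distributivity holds at infinite values because the
    weights are nonnegative and -oo never occurs. *)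
Lemma fconv_fconv s a b f g : functionals f -> functionals g ->
    0 <= s <= 1 -> 0 <= a <= 1 -> 0 <= b <= 1 ->
  fconv s (fconv a f g) (fconv b f g) = fconv ((1 - s) * a + s * b) f g.
Proof.
move=> fN gN /andP[s0 s1] /andP[a0 a1] /andP[b0 b1].
have ls : 0 <= 1 - s by rewrite subr_ge0.
have la : 0 <= 1 - a by rewrite subr_ge0.
have lb : 0 <= 1 - b by rewrite subr_ge0.
apply/funext => x; rewrite /fconv.
have -> : 1 - ((1 - s) * a + s * b) = (1 - s) * (1 - a) + s * (1 - b) by ring.
rewrite !EFinD !EFinM [in RHS]ge0_muleDl ?lee_fin ?mulr_ge0//.
rewrite [X in (_ = _ + X)%E]ge0_muleDl ?lee_fin ?mulr_ge0//.
have nNy (c : R) (u : \bar R) : 0 <= c -> u != -oo%E -> (-oo < c%:E * u)%E.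
  by move=> c0 uN; rewrite ltNye mule_neqNy.
rewrite !muleDr ?ltninfty_adde_def ?inE ?nNy ?fN ?gN//.
by rewrite !muleA addeACA.
Qed.

End segments.

Theorem corollary3p3 (R : realType) (H : completeNormedModType R[i])
    (dot : {dot H for (@Num.conj R[i])})
    (normE : forall x : H, `|x| ^+ 2 = dot x x)
    (C : set (H -> \bar R)) (Phi : (H -> \bar R) -> (H -> \bar R))
    (CR : C `<=` functionals) (C_neq0 : C !=set0) (C_convex : fconvex_set C)
    (PhiR : forall f, C f -> functionals (Phi f)) :
  (pointwise_convex C Phi ->
    forall (lam : R) (lam01 : 0 < lam < 1) (f g : H -> \bar R), C f -> C g ->
    (forall x, Phi (fconv lam f g) x <=
               \int[nu lam01]_(t in `[0%R, 1%R]) Phi (fconv t f g) x)%E /\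
    (forall x, \int[nu lam01]_(t in `[0%R, 1%R]) Phi (fconv t f g) x <=
               (1 - lam)%:E * Phi f x + lam%:E * Phi g x)%E) /\
  (pointwise_concave C Phi ->
    forall (lam : R) (lam01 : 0 < lam < 1) (f g : H -> \bar R), C f -> C g ->
    (forall x, Phi (fconv lam f g) x >=
               \int[nu lam01]_(t in `[0%R, 1%R]) Phi (fconv t f g) x)%E /\
    (forall x, \int[nu lam01]_(t in `[0%R, 1%R]) Phi (fconv t f g) x >=
               (1 - lam)%:E * Phi f x + lam%:E * Phi g x)%E).
Proof.
have hNy f g : C f -> C g -> forall x, neqNy01 (fun t => Phi (fconv t f g) x).
  by move=> Cf Cg x t t01; apply: PhiR; exact: C_convex.
split=> PhiC lam lam01 f g Cf Cg.
- have cvx x : convex01 (fun t => Phi (fconv t f g) x).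
    move=> a b s a01 b01 s01; rewrite -fconv_fconv//; [|exact: CR..].
    by apply: PhiC => //; exact: C_convex.
  split=> x.
    exact: (convex01_le_integral_nu lam lam01 _ (cvx x) (hNy f g Cf Cg x)).
  have := convex01_integral_nu_le lam lam01 _ (cvx x) (hNy f g Cf Cg x).
  by rewrite fconv0 fconv1.
- have ccv x : concave01 (fun t => Phi (fconv t f g) x).
    move=> a b s a01 b01 s01; rewrite -fconv_fconv//; [|exact: CR..].
    by apply: PhiC => //; exact: C_convex.
  split=> x; have [] := concave01_integral_nu lam lam01 _ (ccv x) (hNy f g Cf Cg x).
    by [].
  by rewrite fconv0 fconv1.
Qed.
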